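(* Let $D\geq 1$ be an integer and let $A$ be the free $\mathbb{P}_\searrow$-algebra generated by $D$ elements. Then $H_0^\searrow(A)$ is $D$-dimensional, and $H_n^\searrow(A)=(0)$ for all $n\geq 1$.
   Context: Vector spaces are over a field $K$. A $\mathbb{P}_\searrow$-algebra is a $K$-vector space $A$ (no unit is assumed) with two bilinear products, $(a,b)\mapsto ab$ (the product $m$) and $(a,b)\mapsto a\searrow b$, satisfying for all $a,b,c\in A$: $$(ab)\searrow c=a\searrow(b\searrow c),\qquad a\searrow(bc)=(a\searrow b)c,\qquad (ab)c=a(bc).$$ Homology of a $\mathbb{P}_\searrow$-algebra $A$. For $n\geq1$ let $T_\searrow(A)(n)=\bigoplus_{k=1}^n A^{\otimes n}$; to distinguish the copies, an element of the $k$-th copy of $A^{\otimes n}$ is written with a dot on the $k$-th factor: $v_1\otimes\cdots\otimes\dot v_k\otimes\cdots\otimes v_n$. Let $T_\searrow(A)=\bigoplus_{n\geq1}T_\searrow(A)(n)$. The differential $d:T_\searrow(A)(n)\to T_\searrow(A)(n-1)$ (with $d=0$ on $T_\searrow(A)(1)$) is the linear map sending $v_1\otimes\cdots\otimes\dot v_k\otimes\cdots\otimes v_n$ to $$\sum_{i=1}^{k-2}(-1)^{i-1}\,v_1\otimes\cdots\otimes v_iv_{i+1}\otimes\cdots\otimes\dot v_k\otimes\cdots\otimes v_n$$ $$+\,(-1)^{k-2}\,v_1\otimes\cdots\otimes \overbrace{v_{k-1}\searrow v_k}^{\cdot}\otimes\cdots\otimes v_n\;+\;(-1)^{k-1}\,v_1\otimes\cdots\otimes\overbrace{v_kv_{k+1}}^{\cdot}\otimes\cdots\otimes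 v_n$$ $$+\sum_{i=k+1}^{n-1}(-1)^{i-1}\,v_1\otimes\cdots\otimes\dot v_k\otimes\cdots\otimes v_iv_{i+1}\otimes\cdots\otimes v_n,$$ where the overbrace with a dot indicates the dotted factor, the second term is absent if $k=1$, and the third term is absent if $k=n$. One has $d^2=0$. For $n\in\mathbb{N}=\{0,1,2,\ldots\}$, $$H_n^\searrow(A)=\frac{\mathrm{Ker}\left(d_{\mid T_\searrow(A)(n+1)}\right)}{\mathrm{Im}\left(d_{\mid T_\searrow(A)(n+2)}\right)}.$$ *)

(* Defs.v *)
From HB Require Import structures.
From mathcomp Require Import all_boot all_order all_algebra.
From mathcomp Require Import boolp zify.
From mathcomp.multinomials Require Import freeg.

Set Implicit Arguments.
Unset Strict Implicit.
Unset Printing Implicit Defensive.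

Import GRing.Theory.
Local Open Scope ring_scope.
Local Open Scope quotient_scope.

(* P_searrow-algebras: [mulp a b] is the product and [sea a b] the product
   written with a south-east arrow. *)
HB.mixin Record Lmodule_isPSeAlgebra (K : fieldType) A of GRing.Lmodule K A := {
  mulp : A -> A -> A;
  sea : A -> A -> A;
  mulp_linearr : forall a, linear (mulp a);
  mulp_linearl : forall b, linear (mulp^~ b);
  sea_linearr : forall a, linear (sea a);
  sea_linearl : forall b, linear (sea^~ b);
  sea_mulp : forall a b c, sea (mulp a b) c = sea a (sea b c);
  mulp_sea : forall a b c, sea a (mulp b c) = mulp (sea a b) c;
  mulpA : forall a b c, mulp (mulp a b) c = mulp a (mulp b c)
}.

#[short(type="pseAlgType")]
HB.structure Definition PSeAlgebra (K : fieldType) :=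
  {A of Lmodule_isPSeAlgebra K A & GRing.Lmodule K A}.

Definition pse_morphism (K : fieldType) (A B : pseAlgType K) (f : A -> B) :=
  [/\ linear f,
      forall a b, f (mulp a b) = mulp (f a) (f b)
    & forall a b, f (sea a b) = sea (f a) (f b)].

(* [A] is freely generated by the family [gen] (universal property). *)
Definition pse_free (K : fieldType) (I : Type) (A : pseAlgType K)
    (gen : I -> A) : Prop :=
  forall (B : pseAlgType K) (g : I -> B),
    exists f : A -> B,
      [/\ pse_morphism f, forall i, f (gen i) = g i
        & forall f' : A -> B, pse_morphism f' ->
            (forall i, f' (gen i) = g i) -> f' =1 f].

Fact lin0 (K : fieldType) (U V : lmodType K) (f : U -> V) : linear f -> f 0 = 0.
Proof.
by move=> fL; have := fL (-1) 0 0; rewrite scaler0 addr0 scaleN1r addNr.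
Qed.

Section QuotientSpace.
Variables (K : fieldType) (V : lmodType K) (S : submodClosed V).

(* [submodClosed] does not inherit from [zmodClosed], which [Quotient.quot]
   requires; the alias carries both structures. *)
Definition subspace_pred : {pred V} := S.
HB.instance Definition _ :=
  GRing.isSubmodClosed.Build K V subspace_pred (submodClosedP S).

Definition lquot := Quotient.quot subspace_pred.
HB.instance Definition _ := GRing.Zmodule.on lquot.

Definition lpi (x : V) : lquot := \pi_(Quotient.quot subspace_pred) x.

Lemma lpi_eq x y : (lpi x = lpi y) <-> (x - y \in S).
Proof.
have -> : (x - y \in S) = (lpi x == lpi y).
  exact: (Quotient.idealrBE subspace_pred x y).
by split=> /eqP.
Qed.

Lemma lpi_surj (q : lquot) : exists x, lpi x = q.
Proof. by exists (repr q); rewrite /lpi reprK. Qed.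

Lemma lpiD : {morph lpi : x y / x + y}.
Proof. by move=> x y; rewrite /lpi raddfD. Qed.

Definition lquot_scale (c : K) (q : lquot) : lquot := lpi (c *: repr q).

Lemma lquot_scale_pi c x : lquot_scale c (lpi x) = lpi (c *: x).
Proof.
by apply/lpi_eq; rewrite -scalerBr rpredZ //; apply/lpi_eq; rewrite /lpi reprK.
Qed.

Fact lquot_scaleA a b q :
  lquot_scale a (lquot_scale b q) = lquot_scale (a * b) q.
Proof. by case: (lpi_surj q) => x <-; rewrite !lquot_scale_pi scalerA. Qed.

Fact lquot_scale1 : left_id 1 lquot_scale.
Proof. by move=> q; case: (lpi_surj q) => x <-; rewrite lquot_scale_pi scale1r. Qed.

Fact lquot_scaleDr : right_distributive lquot_scale +%R.
Proof.
move=> a q r; case: (lpi_surj q) => x <-; case: (lpi_surj r) => y <-.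
by rewrite -lpiD !lquot_scale_pi scalerDr lpiD.
Qed.

Fact lquot_scaleDl q : {morph lquot_scale^~ q : a b / a + b}.
Proof.
move=> a b; case: (lpi_surj q) => x <-.
by rewrite !lquot_scale_pi scalerDl lpiD.
Qed.

HB.instance Definition _ := GRing.Zmodule_isLmodule.Build K lquot
  lquot_scaleA lquot_scale1 lquot_scaleDr lquot_scaleDl.

Lemma lpi_linear : linear lpi.
Proof. by move=> a x y; rewrite lpiD -lquot_scale_pi. Qed.

End QuotientSpace.

Section Span.
Variables (K : fieldType) (V : lmodType K) (R : V -> Prop).

Inductive in_span : V -> Prop :=
| in_span_gen x : R x -> in_span x
| in_span0 : in_span 0
| in_spanP c x y : in_span x -> in_span y -> in_span (c *: x + y).

Definition span_pred : {pred V} := fun x => `[< in_span x >].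

Fact span_pred_submod : submod_closed span_pred.
Proof.
split; first by apply/asboolP; exact: in_span0.
by move=> c x y /asboolP hx /asboolP hy; apply/asboolP; exact: in_spanP.
Qed.

HB.instance Definition _ :=
  GRing.isSubmodClosed.Build K V span_pred span_pred_submod.

End Span.

HB.instance Definition _ (K : fieldType) (X : choiceType) (V : lmodType K)
    (f : X -> V) :=
  GRing.isZmodMorphism.Build {freeg X / K} V (fglift f) (lift_is_additive f).

Section TensorPower.
Variables (K : fieldType) (A : lmodType K) (n : nat).
Implicit Types (v : {ffun 'I_n -> A}) (i : 'I_n) (a : A).

Definition upd v i a : {ffun 'I_n -> A} :=
  [ffun j => if j == i then a else v j].

Definition multilinear (V : lmodType K) (f : {ffun 'I_n -> A} -> V) :=
  forall v i, linear (fun a => f (upd v i a)).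

Inductive tensor_rel : {freeg {ffun 'I_n -> A} / K} -> Prop :=
| TensorRel v i c a b :
    tensor_rel
      (<< upd v i (c *: a + b) >> - (c *: << upd v i a >> + << upd v i b >>)).

(* The [n]-th tensor power: the free vector space on families of [n] vectors,
   modulo multilinearity. *)
Definition tpow := lquot (span_pred tensor_rel).
HB.instance Definition _ := GRing.Lmodule.on tpow.

Definition tens v : tpow := lpi (span_pred tensor_rel) << v >>.

Lemma tens_multilinear : multilinear tens.
Proof.
move=> v i c a b; rewrite /tens -lpi_linear; apply/lpi_eq/asboolP.
exact/in_span_gen/TensorRel.
Qed.

Definition tlift (V : lmodType K) (f : {ffun 'I_n -> A} -> V) (t : tpow) : V :=
  fglift f (repr t).

Fact fglift_linear (V : lmodType K) (f : {ffun 'I_n -> A} -> V) :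
  linear (fglift f).
Proof.
have fgZ c x : fglift f (c *: x) = c *: fglift f x.
  have -> : x = \sum_(v <- dom x) << coeff v x *g v >> by rewrite freeg_sumE.
  rewrite scaler_sumr !raddf_sum /=; apply: eq_bigr => v _.
  have -> : c *: << coeff v x *g v >> = << c * coeff v x *g v >>.
    by apply/eqP/freeg_eqP => w; rewrite coeffZ !coeffU mulrA.
  by rewrite !liftU scalerA.
by move=> c x y; rewrite raddfD /= fgZ.
Qed.

Lemma tlift_pi (V : lmodType K) (f : {ffun 'I_n -> A} -> V) :
  multilinear f ->
  forall x, tlift f (lpi (span_pred tensor_rel) x) = fglift f x.
Proof.
move=> fM x.
have fS z : z \in span_pred tensor_rel -> fglift f z = 0.
  move=> /asboolP; elim=> {z} [_ [v i c a b]||c y z _ hy _ hz].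
  - by rewrite raddfB /= fglift_linear !liftU !scale1r fM subrr.
  - exact: raddf0.
  - by rewrite fglift_linear hy hz scaler0 addr0.
apply/eqP; rewrite -subr_eq0 /tlift -raddfB; apply/eqP/fS.
by apply/lpi_eq; rewrite /lpi reprK.
Qed.

Lemma tlift_tens (V : lmodType K) (f : {ffun 'I_n -> A} -> V) :
  multilinear f -> forall v, tlift f (tens v) = f v.
Proof. by move=> fM v; rewrite tlift_pi // liftU scale1r. Qed.

Lemma tlift_linear (V : lmodType K) (f : {ffun 'I_n -> A} -> V) :
  multilinear f -> linear (tlift f).
Proof.
move=> fM c x y; case: (lpi_surj x) (lpi_surj y) => {}x <- [{}y <-].
by rewrite -lpi_linear !tlift_pi // fglift_linear.
Qed.

Lemma tpow_ind (P : tpow -> Prop) :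
  (forall v, P (tens v)) -> P 0 ->
  (forall c x y, P x -> P y -> P (c *: x + y)) -> forall t, P t.
Proof.
move=> Pt P0 PD t; case: (lpi_surj t) => {t} x <-.
rewrite -(freeg_sumE x); elim: (dom x) => [|v r IHr].
  by rewrite big_nil (lin0 (@lpi_linear _ _ _)).
rewrite big_cons.
have -> : << coeff v x *g v >> = coeff v x *: << v >> :> {freeg _ / K}.
  by apply/eqP/freeg_eqP => w; rewrite coeffZ !coeffU mul1r.
by rewrite lpi_linear; apply: PD => //; apply: Pt.
Qed.

End TensorPower.

Section Complex.
Variables (K : fieldType) (A : pseAlgType K).

(* Indices start at 0: factors [i] and [i.+1] of [v] are replaced by their
   product, [op] being [mulp] or [sea]. *)
Definition contract n (op : A -> A -> A) (i : 'I_n) (v : {ffun 'I_n.+1 -> A}) :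
    {ffun 'I_n -> A} :=
  [ffun j : 'I_n => if (j < i)%N then v (inord j)
                    else if j == i then op (v (inord i)) (v (inord i.+1))
                    else v (inord j.+1)].

Fact redot_subproof n (i : 'I_n) (k : 'I_n.+1) : (unbump i k < n)%N.
Proof.
rewrite /unbump; case: ltnP => ik; have := ltn_ord k; have := ltn_ord i; lia.
Qed.

(* Position of the dot after contracting factors [i] and [i.+1], when it was at
   [k]: [k.-1] if [i < k], and [k] otherwise. *)
Definition redot n (i : 'I_n) (k : 'I_n.+1) : 'I_n := Ordinal (redot_subproof i k).

Definition face n (op : A -> A -> A) (i : 'I_n) : tpow A n.+1 -> tpow A n :=
  tlift (fun v => tens (contract op i v)).

(* [Tsea n] is the direct sum of [n] copies of the [n]-th tensor power, one for
   each position of the dot; it is null for [n = 0]. *)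
Definition Tsea n := {ffun 'I_n -> tpow A n}.
HB.instance Definition _ n := GRing.Lmodule.on (Tsea n).

Definition tinj n (k : 'I_n) (t : tpow A n) : Tsea n :=
  [ffun l => if l == k then t else 0].

Definition dtens n (k : 'I_n) (v : {ffun 'I_n -> A}) : Tsea n := tinj k (tens v).

(* The contracted pair is multiplied with [sea] exactly when the dot is on its
   second factor. *)
Definition opk n (i : 'I_n) (k : 'I_n.+1) : A -> A -> A :=
  if i.+1 == k then sea else mulp.

(* [dsea] from [Tsea n.+1] to [Tsea n]; its value on dotted tensors is
   [dsea_dtens]. With indices starting at 1, the four groups of terms of the
   differential, [i <= k-2], [i = k-1], [i = k] and [i >= k+1], all have sign
   [(-1)^(i-1)]; for [n = 0] the target is null, hence [dsea = 0]. *)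
Definition dsea n (x : Tsea n.+1) : Tsea n :=
  \sum_(k < n.+1) \sum_(i < n)
    (-1) ^+ i *: tinj (redot i k) (face (opk i k) i (x k)).

Lemma contract_upd n (op : A -> A -> A) (i : 'I_n) (v : {ffun 'I_n.+1 -> A})
    (l : 'I_n.+1) (a : A) :
  contract op i (upd v l a) =
  upd (contract op i v) (redot i l)
      (if l == i :> nat then op a (v (inord i.+1))
       else if l == i.+1 :> nat then op (v (inord i)) a else a).
Proof.
have iE : (inord i : 'I_n.+1) = i :> nat by rewrite inordK // ltnW // ltnS.
have iSE : (inord i.+1 : 'I_n.+1) = i.+1 :> nat by rewrite inordK // ltnS.
apply/ffunP => j; rewrite !ffunE -!val_eqE /= iE iSE.
have -> : (inord j : 'I_n.+1) = j :> nat by rewrite inordK // ltnW // ltnS.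
have -> : (inord j.+1 : 'I_n.+1) = j.+1 :> nat by rewrite inordK // ltnS.
rewrite /unbump.
case: (ltnP i l) => il; rewrite ?subn0 ?subn1.
  have -> : (l == i :> nat) = false by lia.
  have -> : (j == l.-1 :> nat) = (j.+1 == l) by lia.
  have -> : (i == l :> nat) = false by lia.
  rewrite [i.+1 == _]eq_sym.
  case: ltnP => ji.
    have -> : (j == l :> nat) = false by lia.
    by have -> : (j.+1 == l) = false by lia.
  case: (eqVneq (j : nat) i) => [->|nji].
    by rewrite [i.+1 == _]eq_sym; case: ifP.
  have [jl|//] := eqVneq j.+1 l.
  by have -> : (l == i.+1 :> nat) = false by lia.
have -> : (l == i.+1 :> nat) = false by lia.
have -> : (i.+1 == l) = false by lia.
case: ltnP => ji.
  case: eqP => // jl; by have -> : (l == i :> nat) = false by lia.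
have -> : (j.+1 == l) = false by lia.
case: (eqVneq (j : nat) i) => [->|nji]; first by rewrite eq_sym; case: eqP.
by have -> : (j == l :> nat) = false by lia.
Qed.

Lemma opk_linearl n (i : 'I_n) k b : linear (opk i k ^~ b).
Proof. by rewrite /opk; case: ifP => _; [exact: sea_linearl|exact: mulp_linearl]. Qed.

Lemma opk_linearr n (i : 'I_n) k a : linear (opk i k a).
Proof. by rewrite /opk; case: ifP => _; [exact: sea_linearr|exact: mulp_linearr]. Qed.

Lemma contract_multilinear n (i : 'I_n) k :
  multilinear (fun v => tens (contract (opk i k) i v)).
Proof.
move=> v l c a b; rewrite !contract_upd.
by case: ifP => _; [|case: ifP => _];
  rewrite ?opk_linearl ?opk_linearr tens_multilinear.
Qed.

Lemma face_linear n (i : 'I_n) k : linear (face (opk i k) i).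
Proof. exact/tlift_linear/contract_multilinear. Qed.

Lemma tinj_linear n (k : 'I_n) : linear (tinj k).
Proof.
by move=> c x y; apply/ffunP=> l; rewrite !ffunE; case: eqP => // _; rewrite scaler0 addr0.
Qed.

Lemma dsea_linear n : linear (@dsea n).
Proof.
move=> c x y; rewrite /dsea scaler_sumr -big_split; apply: eq_bigr => k _ /=.
rewrite scaler_sumr -big_split; apply: eq_bigr => i _ /=.
by rewrite !ffunE face_linear tinj_linear scalerDr !scalerA mulrC.
Qed.

HB.instance Definition _ n :=
  GRing.isLinear.Build K (Tsea n.+1) (Tsea n) *:%R (@dsea n) (@dsea_linear n).

Lemma dsea_dtens n (k : 'I_n.+1) (v : {ffun 'I_n.+1 -> A}) :
  dsea (dtens k v) =
  \sum_(i < n) (-1) ^+ i *: dtens (redot i k) (contract (opk i k) i v).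
Proof.
rewrite /dsea (bigD1 k) //= [X in _ + X]big1 ?addr0 => [|l lk].
  apply: eq_bigr => i _; rewrite ffunE eqxx; congr (_ *: tinj _ _).
  exact/tlift_tens/contract_multilinear.
apply: big1 => i _; rewrite ffunE (negPf lk).
by rewrite (lin0 (face_linear i l)) (lin0 (tinj_linear _)) scaler0.
Qed.

Lemma Tsea_ind n (P : Tsea n -> Prop) :
  (forall k v, P (dtens k v)) -> P 0 ->
  (forall c x y, P x -> P y -> P (c *: x + y)) -> forall x, P x.
Proof.
move=> Pd P0 PD x.
have -> : x = \sum_k tinj k (x k).
  apply/ffunP => l; rewrite sum_ffunE (bigD1 l) //= big1 ?addr0 ?ffunE ?eqxx //.
  by move=> k kl; rewrite ffunE eq_sym (negPf kl).
elim: (index_enum _) => [|k r IHr]; first by rewrite big_nil.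
rewrite big_cons -[tinj _ _]scale1r; apply: (PD) => //.
elim/tpow_ind: (x k) => [v||c t u Pt Pu]; first exact: Pd.
  by rewrite (lin0 (tinj_linear k)).
by rewrite tinj_linear; apply: PD.
Qed.

Lemma contract_inord n (op : A -> A -> A) (i : 'I_n.+1)
    (v : {ffun 'I_n.+2 -> A}) m : (m <= n)%N ->
  contract op i v (inord m) =
  if (m < i)%N then v (inord m)
  else if m == i then op (v (inord i)) (v (inord i.+1)) else v (inord m.+1).
Proof. by move=> mn; rewrite ffunE -val_eqE /= !inordK. Qed.

Lemma redot_redot n (i j : 'I_n) (k : 'I_n.+2) : (i <= j)%N ->
  redot j (redot (widen_ord (leqnSn n) i) k) = redot i (redot (fintype.lift ord0 j) k).
Proof.
move=> ij; apply/val_inj; rewrite /= /unbump /bump /=.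
by case: (ltnP i k); case: (ltnP j.+1 k); lia.
Qed.

Lemma contract_contract n (i j : 'I_n) (k : 'I_n.+2)
    (v : {ffun 'I_n.+2 -> A}) : (i <= j)%N ->
  let i' := widen_ord (leqnSn n) i in let j' := fintype.lift ord0 j in
  contract (opk j (redot i' k)) j (contract (opk i' k) i' v) =
  contract (opk i (redot j' k)) i (contract (opk j' k) j' v).
Proof.
move=> ij i' j'; apply/ffunP => l; rewrite [LHS]ffunE [RHS]ffunE -!val_eqE /=.
have ln := ltn_ord l; have iN := ltn_ord i; have jN := ltn_ord j.
have j'E : j' = j.+1 :> nat by [].
have i'E : i' = i :> nat by [].
rewrite !contract_inord ?j'E ?i'E; try lia.
have opj : opk j (redot i' k) = opk j' k \/ i = j :> nat.
  have [->|nij] := eqVneq (i : nat) j; [by right|left].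
  rewrite /opk /= /unbump /bump /= ?j'E; congr (if _ then _ else _).
  by case: (ltnP i k) => ? /=; lia.
have opi : opk i (redot j' k) = opk i' k \/ i = j :> nat.
  have [->|nij] := eqVneq (i : nat) j; [by right|left].
  rewrite /opk /= /unbump /bump /= ?i'E; congr (if _ then _ else _).
  by case: (ltnP j.+1 k) => ? /=; lia.
have [eij|nij] := eqVneq (i : nat) j; last first.
  case: opj opi nij => [-> [->|->]|->]; rewrite ?eqxx // => nij.
  by do ! case: ifP => ? //; try lia; congr (opk _ _ (v (inord _)) (v (inord _)));
    lia.
have opA a b c : opk j (redot i' k) (opk i' k a b) c =
                 opk i (redot j' k) a (opk j' k b c).
  rewrite /opk /= /unbump /bump /= -eij add1n.
  case: (ltnP i k) => ik; case: (ltnP i.+1 k) => ik1; rewrite ?subn0 ?subn1;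
    do ! case: eqP => ?; try lia; rewrite ?sea_mulp ?mulp_sea ?mulpA //.
rewrite -eij !ltnSn !ltnn !eqxx.
case: (ltngtP l i) => li; first by rewrite ltnS (ltnW li).
  have -> : (l.+1 < i)%N = false by lia.
  have -> : (l.+1 == i)%N = false by lia.
  have -> : (l.+1 < i.+1)%N = false by lia.
  by have -> : (l.+1 == i.+1)%N = false by lia.
have -> : (i.+1 < i)%N = false by lia.
have -> : (i.+1 == i)%N = false by lia.
exact: opA.
Qed.

Lemma dsea_dsea n (x : Tsea n.+2) : dsea (dsea x) = 0.
Proof.
elim/Tsea_ind: x => [k v||c x y dx dy]; last by rewrite !dsea_linear dx dy scaler0 addr0.
  2: by rewrite !linear0.
rewrite dsea_dtens linear_sum /=.
pose F (i : 'I_n.+1) (j : 'I_n) : Tsea n :=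
  dtens (redot j (redot i k)) (contract (opk j (redot i k)) j (contract (opk i k) i v)).
have -> : \sum_(i < n.+1) dsea ((-1) ^+ i *: dtens (redot i k) (contract (opk i k) i v))
   = \sum_(i < n.+1) \sum_(j < n) (-1) ^+ (i + j) *: F i j.
  apply: eq_bigr => i _; rewrite linearZ /= dsea_dtens scaler_sumr.
  by apply: eq_bigr => j _; rewrite scalerA exprD.
rewrite exchange_big /=.
under eq_bigr => j _ do rewrite (bigID (fun i : 'I_n.+1 => (i <= j)%N)) /=.
rewrite big_split /=.
under eq_bigr => j _ do
  rewrite big_mkcond big_ord_recr /= leqNgt ltn_ord addr0 -big_mkcond /=.
under [X in _ + X]eq_bigr => j _ do
  rewrite big_mkcond big_ord_recl /= add0r -big_mkcond /=.
rewrite [X in _ + X](exchange_big_dep xpredT) //= -big_split big1 //= => j _.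
under [X in _ + X]eq_bigl => i do rewrite /bump add1n -ltnNge ltnS.
rewrite -big_split big1 //= => i ij.
rewrite /F redot_redot // contract_contract // -scalerDl /bump add1n addSn exprS.
by rewrite mulN1r addnC subrr scale0r.
Qed.

Definition cycle_pred n : {pred Tsea n.+1} := [pred x | dsea x == 0].

Lemma cycleE n (x : Tsea n.+1) : (x \in @cycle_pred n) = (dsea x == 0).
Proof. by []. Qed.

Fact cycle_submod n : submod_closed (@cycle_pred n).
Proof.
split=> [|c x y]; rewrite !cycleE; first by rewrite (lin0 (@dsea_linear n)).
by move=> /eqP dx /eqP dy; rewrite dsea_linear dx dy scaler0 addr0.
Qed.

HB.instance Definition _ n :=
  GRing.isSubmodClosed.Build K (Tsea n.+1) (@cycle_pred n) (@cycle_submod n).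

Definition cycles n := {x : Tsea n.+1 | x \in @cycle_pred n}.
HB.instance Definition _ n := SubType.on (cycles n).
HB.instance Definition _ n := [Choice of cycles n by <:].
HB.instance Definition _ n := [SubChoice_isSubLmodule of cycles n by <:].

(* By [dsea_dsea] every boundary is a cycle, so that this is the whole image. *)
Definition boundary_pred n : {pred cycles n} :=
  fun z => `[< exists y : Tsea n.+2, dsea y = val z >].

Fact boundary_submod n : submod_closed (@boundary_pred n).
Proof.
split=> [|c x y]; first by apply/asboolP; exists 0; rewrite (lin0 (@dsea_linear _)).
move=> /asboolP [x' dx'] /asboolP [y' dy']; apply/asboolP.
by exists (c *: x' + y'); rewrite dsea_linear dx' dy'.
Qed.

HB.instance Definition _ n :=
  GRing.isSubmodClosed.Build K (cycles n) (@boundary_pred n) (@boundary_submod n).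

(* [Hsea n] is Ker(d on [Tsea n.+1]) / Im(d on [Tsea n.+2]). *)
Definition Hsea n := lquot (@boundary_pred n).
HB.instance Definition _ n := GRing.Lmodule.on (Hsea n).

End Complex.

(* Main.v *)
Require Import Defs.
From HB Require Import structures.
From mathcomp Require Import all_boot all_order all_algebra.
From mathcomp Require Import boolp zify.

(** The idea is that [T(A)] is a two-sided bar complex and that a free
    algebra has free, hence acyclic, coefficients for it.

    The three axioms say that [A] is a bimodule over the associative algebra
    [(A, mulp)], with left action [sea] and right action [mulp]. In the
    chain [v_1 (x) .. (x) v_n] the dotted factor is an element of this
    bimodule and the other factors are bar elements acting from both sides,
    so that the homology is [Tor] of the trivial module [K] and of [A] over
    the enveloping algebra of [A^+], where [A^+] is [A] with a unit added.
    When [A] is free on a set [X], it is also free on [X] as a bimodule,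
    isomorphic to [A^+ (x) KX (x) A^+]: with planar forests as a basis, a
    forest is uniquely [(F sea x) G], where [x] decorates the root of its
    first tree, [F] is the forest above that root and [G] the rest. Hence
    the homology is [KX], in degree 0.

    The freeness is derived from the universal property of [A], without any
    basis, by applying it to the square-zero extension of [A] by a bimodule
    ([free_bimodule_ex], [free_bimodule_uniq]). Mapping [A] to the bimodules
    [A^+ (x) A] and [A (x) A^+] yields linear maps which extract the left
    part [F] or the right part [G] of an element ([left_splitting],
    [right_splitting]). Applied to the dotted factor they define two
    homotopies: the first contracts the complex onto the chains dotted on
    their first factor ([left_homotopy_contraction]), the second contracts
    these in positive degree ([right_homotopy_contraction]). In degree 0
    homology is the quotient of [A] by all the values of the two products;
    linear maps out of it are bimodule maps from [A] to spaces with zero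
    actions, that is, by freeness, arbitrary functions on the generators. *)

Import GRing.Theory.
Local Open Scope ring_scope.

Set Implicit Arguments.
Unset Strict Implicit.

(** * Linear and bilinear maps *)

Section LinearMaps.
Variable K : fieldType.

Definition bilinear2 (U V W : lmodType K) (f : U -> V -> W) : Prop :=
  (forall u, linear (f u)) /\ (forall v, linear (f^~ v)).

Lemma lin_add (U W : lmodType K) (f : U -> W) :
  linear f -> {morph f : x y / x + y}.
Proof. by move=> fL x y; have := fL 1 x y; rewrite !scale1r. Qed.

Lemma linear_lincomb (U W : lmodType K) (f : U -> W) n (c : 'I_n -> K)
    (u : 'I_n -> U) :
  linear f -> f (\sum_i c i *: u i) = \sum_i c i *: f (u i).
Proof.
move=> fL; elim/big_rec2: _ => [|i y x _ <-]; first exact: lin0.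
exact: fL.
Qed.

Lemma lincomb_addr (U : lmodType K) c (a b x a' b' y : U) :
  a + b = x -> a' + b' = y -> c *: a + a' + (c *: b + b') = c *: x + y.
Proof. by move=> <- <-; rewrite addrACA -scalerDr. Qed.

Lemma lincomb_subr (U : lmodType K) c (a b x t a' b' y u : U) :
  a + b = x - t -> a' + b' = y - u ->
  c *: a + a' + (c *: b + b') = c *: x + y - (c *: t + u).
Proof.
by move=> ab ab'; rewrite (lincomb_addr c ab ab') scalerBr addrACA opprD.
Qed.

Lemma lincomb0 (U : lmodType K) c (a b : U) :
  a = 0 -> b = 0 -> c *: a + b = 0.
Proof. by move=> -> ->; rewrite scaler0 addr0. Qed.

Lemma linear_comp (U V W : lmodType K) (f : V -> W) (g : U -> V) :
  linear f -> linear g -> linear (f \o g).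
Proof. by move=> fL gL c x y; rewrite /= gL fL. Qed.

Lemma linear_pair (U V W : lmodType K) (f : U -> V) (g : U -> W) :
  linear f -> linear g -> linear (fun x => (f x, g x)).
Proof. by move=> fL gL c x y; rewrite fL gL. Qed.

Lemma linear_add (U V : lmodType K) (f g : U -> V) :
  linear f -> linear g -> linear (fun x => f x + g x).
Proof. by move=> fL gL c x y; rewrite fL gL scalerDr addrACA. Qed.

Lemma linear_zero (U V : lmodType K) : linear (fun _ : U => 0 : V).
Proof. by move=> c x y; rewrite scaler0 addr0. Qed.

End LinearMaps.

(** * A free algebra is a free bimodule over itself *)

Section FreeBimodule.
Variables (K : fieldType) (A : pseAlgType K).

Lemma mulp_bilinear : bilinear2 (@mulp K A).
Proof. by split; [exact: mulp_linearr|exact: mulp_linearl]. Qed.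

Lemma sea_bilinear : bilinear2 (@sea K A).
Proof. by split; [exact: sea_linearr|exact: sea_linearl]. Qed.

(** The axioms of a P_searrow-algebra say precisely that [A] is a bimodule over
    the associative algebra [(A, mulp)], acting by [sea] on the left and by
    [mulp] on the right. *)
Record bimodule (V : lmodType K) (L : A -> V -> V) (R : V -> A -> V) : Prop :=
  Bimodule {
    bimodLl : bilinear2 L;
    bimodRl : bilinear2 R;
    bimodLA : forall a b v, L (mulp a b) v = L a (L b v);
    bimodLR : forall a v b, L a (R v b) = R (L a v) b;
    bimodRA : forall v a b, R (R v a) b = R v (mulp a b) }.

Record bimod_morphism (V : lmodType K) (L : A -> V -> V) (R : V -> A -> V)
    (f : A -> V) : Prop := BimodMorphism {
  bimod_linear : linear f;
  bimod_mulp : forall a b, f (mulp a b) = R (f a) b;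
  bimod_sea : forall a b, f (sea a b) = L a (f b) }.

Section Extension.
Variables (V : lmodType K) (L : A -> V -> V) (R : V -> A -> V).

(** The square-zero extension of [A] by a bimodule [V]: in a product the
    [V]-component of one factor only survives, namely that of the factor which
    the operation treats as a module element. Morphisms [A -> A * V] over [A]
    are thus exactly the bimodule morphisms [A -> V]. *)
Definition extension of bimodule L R : Type := (A * V)%type.

Variable bm : bimodule L R.
Notation B := (extension bm).

HB.instance Definition _ := GRing.Lmodule.copy B (A * V)%type.

Definition ext_mulp (x y : B) : B := (mulp x.1 y.1, R x.2 y.1).
Definition ext_sea (x y : B) : B := (sea x.1 y.1, L x.1 y.2).

Fact ext_mulp_linearr x : linear (ext_mulp x).
Proof.
move=> c y z; congr pair => /=; first exact: mulp_linearr.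
exact: (bimodRl bm).1.
Qed.

Fact ext_mulp_linearl y : linear (ext_mulp^~ y).
Proof.
move=> c x z; congr pair => /=; first exact: mulp_linearl.
exact: (bimodRl bm).2.
Qed.

Fact ext_sea_linearr x : linear (ext_sea x).
Proof.
move=> c y z; congr pair => /=; first exact: sea_linearr.
exact: (bimodLl bm).1.
Qed.

Fact ext_sea_linearl y : linear (ext_sea^~ y).
Proof.
move=> c x z; congr pair => /=; first exact: sea_linearl.
exact: (bimodLl bm).2.
Qed.

Fact ext_sea_mulp x y z : ext_sea (ext_mulp x y) z = ext_sea x (ext_sea y z).
Proof. by rewrite /ext_sea /= sea_mulp (bimodLA bm). Qed.

Fact ext_mulp_sea x y z : ext_sea x (ext_mulp y z) = ext_mulp (ext_sea x y) z.
Proof. by rewrite /ext_sea /ext_mulp /= mulp_sea (bimodLR bm). Qed.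

Fact ext_mulpA x y z : ext_mulp (ext_mulp x y) z = ext_mulp x (ext_mulp y z).
Proof. by rewrite /ext_mulp /= mulpA (bimodRA bm). Qed.

HB.instance Definition _ := Lmodule_isPSeAlgebra.Build K B
  ext_mulp_linearr ext_mulp_linearl ext_sea_linearr ext_sea_linearl
  ext_sea_mulp ext_mulp_sea ext_mulpA.

End Extension.

Variables (I : Type) (gen : I -> A).
Hypothesis freeA : pse_free gen.

Lemma free_endomorphism (f : A -> A) :
  pse_morphism f -> (forall i, f (gen i) = gen i) -> f =1 id.
Proof.
move=> fM fg; have [h [_ _ hU]] := freeA gen.
by move=> a; rewrite (hU f) // -(hU id).
Qed.

(** The universal property at [extension bm] gives a morphism whose first
    component is the identity; its second component is the wanted map. *)
Lemma free_bimodule_ex (V : lmodType K) (L : A -> V -> V) (R : V -> A -> V)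
    (g : I -> V) : bimodule L R ->
  exists2 f, bimod_morphism L R f & forall i, f (gen i) = g i.
Proof.
move=> bm; have [F [[FL Fm Fs] Fg _]] :=
  freeA (fun i => (gen i, g i) : extension bm).
have F1 a : (F a).1 = a.
  apply: (free_endomorphism (f := fun a => (F a).1)) => [|i]; last first.
    by rewrite Fg.
  by split=> [c b b'|b b'|b b'] /=; rewrite ?FL ?Fm ?Fs.
exists (fun a => (F a).2) => [|i]; last by rewrite Fg.
split=> [c a b|a b|a b]; first by rewrite FL.
  by rewrite Fm /= F1.
by rewrite Fs /= F1.
Qed.

(** The graphs of [f] and [f'] are algebra morphisms into [extension bm] which
    agree on the generators. *)
Lemma free_bimodule_uniq (V : lmodType K) (L : A -> V -> V) (R : V -> A -> V)
    (f f' : A -> V) : bimodule L R -> bimod_morphism L R f ->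
  bimod_morphism L R f' -> (forall i, f (gen i) = f' (gen i)) -> f =1 f'.
Proof.
move=> bm fM f'M ff' a.
have ME h : bimod_morphism L R h ->
    pse_morphism (fun a => (a, h a) : extension bm).
  by case=> hL hm hs; split=> [c b b'|b b'|b b']; rewrite ?hL ?hm ?hs.
have [h [_ _ hU]] := freeA (fun i => (gen i, f (gen i)) : extension bm).
suff [] : ((a, f a) : extension bm) = (a, f' a) by [].
rewrite [LHS](hU _ (ME _ fM)) // [RHS](hU _ (ME _ f'M)) // => i.
by rewrite ff'.
Qed.

End FreeBimodule.

(** * The tensor square *)

Section TensorSquare.
Variables (K : fieldType) (A : lmodType K).

Definition ten2 (a b : A) : tpow A 2 :=
  tens [ffun j : 'I_2 => if j == ord0 then a else b].

Definition lift2 (V : lmodType K) (f : A -> A -> V) : tpow A 2 -> V :=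
  tlift (fun u : {ffun 'I_2 -> A} => f (u ord0) (u ord_max)).

Lemma tensE2 (u : {ffun 'I_2 -> A}) : tens u = ten2 (u ord0) (u ord_max).
Proof.
congr tens; apply/ffunP => -[[|[|//]] lj]; rewrite ffunE; congr (u _);
  exact/val_inj.
Qed.

Lemma multilinear2 (V : lmodType K) (f : A -> A -> V) : bilinear2 f ->
  multilinear (fun u : {ffun 'I_2 -> A} => f (u ord0) (u ord_max)).
Proof.
case=> fr fl u [[|[|//]] lj] c a b; rewrite !ffunE -!val_eqE /=.
  by rewrite fl.
by rewrite fr.
Qed.

Lemma lift2_linear (V : lmodType K) (f : A -> A -> V) :
  bilinear2 f -> linear (lift2 f).
Proof. by move=> /multilinear2; apply: tlift_linear. Qed.

Lemma lift2_ten2 (V : lmodType K) (f : A -> A -> V) :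
  bilinear2 f -> forall a b, lift2 f (ten2 a b) = f a b.
Proof. by move=> /multilinear2/tlift_tens fE a b; rewrite /lift2 fE !ffunE. Qed.

Lemma ten2_bilinear : bilinear2 ten2.
Proof.
have E0 a b b' : ten2 a b =
    tens (upd [ffun j : 'I_2 => if j == ord0 then a else b'] ord_max b).
  by congr tens; apply/ffunP => -[[|[|//]] lj]; rewrite !ffunE.
have E1 a b a' : ten2 a b =
    tens (upd [ffun j : 'I_2 => if j == ord0 then a' else b] ord0 a).
  by congr tens; apply/ffunP => -[[|[|//]] lj]; rewrite !ffunE.
split=> [a|b] c x y.
  by rewrite !(E0 a _ 0) tens_multilinear.
by rewrite !(E1 _ b 0) tens_multilinear.
Qed.

Lemma ten2_ext (V : lmodType K) (f g : tpow A 2 -> V) :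
  linear f -> linear g -> (forall a b, f (ten2 a b) = g (ten2 a b)) -> f =1 g.
Proof.
move=> fL gL fg; elim/tpow_ind => [u||c t t' ft ft'].
- by rewrite tensE2.
- by rewrite !lin0.
- by rewrite fL gL ft ft'.
Qed.

End TensorSquare.

(** * Splittings of the two actions on a free algebra *)

Section Splittings.
Variables (K : fieldType) (A : pseAlgType K).

Definition lact2 (op : A -> A -> A) (a : A) : tpow A 2 -> tpow A 2 :=
  lift2 (fun u w => ten2 (op a u) w).
Definition ract2 (t : tpow A 2) (b : A) : tpow A 2 :=
  lift2 (fun u w => ten2 u (mulp w b)) t.

(** Gives bilinearity of the actions below in the algebra variable as well. *)
Lemma lift2_param (V : lmodType K) (f : A -> A -> A -> V) :
  (forall a, bilinear2 (f a)) -> (forall u w, linear (fun a => f a u w)) ->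
  bilinear2 (fun (a : A) (t : tpow A 2) => lift2 (f a) t).
Proof.
move=> fb fl; split=> [a|t c a b]; first exact: lift2_linear.
move: t; apply: ten2_ext => [|d s t|u w]; first exact: lift2_linear.
  rewrite !(lift2_linear (fb _)) !scalerDr !scalerA !(mulrC c).
  by rewrite addrACA.
by rewrite !lift2_ten2 // fl.
Qed.

Lemma lact2_fun_bilinear (op : A -> A -> A) a :
  bilinear2 op -> bilinear2 (fun u w : A => ten2 (op a u) w).
Proof.
case=> opr _; split=> [u|w] c x y; first exact: (ten2_bilinear A).1.
by rewrite opr (ten2_bilinear A).2.
Qed.

Lemma ract2_fun_bilinear b : bilinear2 (fun u w : A => ten2 u (mulp w b)).
Proof.
split=> [u|w] c x y; last exact: (ten2_bilinear A).2.
by rewrite mulp_linearl (ten2_bilinear A).1.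
Qed.

Lemma lact2_bilinear (op : A -> A -> A) : bilinear2 op -> bilinear2 (lact2 op).
Proof.
move=> opb; apply: (lift2_param (f := fun a u w => ten2 (op a u) w)).
  by move=> a; apply: lact2_fun_bilinear.
by move=> u w c x y; rewrite opb.2 (ten2_bilinear A).2.
Qed.

Lemma ract2_bilinear : bilinear2 ract2.
Proof.
have [rl rr] : bilinear2 (fun (b : A) (t : tpow A 2) => ract2 t b).
  apply: (lift2_param (f := fun b u w => ten2 u (mulp w b))).
    exact: ract2_fun_bilinear.
  by move=> u w c x y; rewrite mulp_linearr (ten2_bilinear A).1.
by split.
Qed.

Lemma lact2_ten2 (op : A -> A -> A) a u w : bilinear2 op ->
  lact2 op a (ten2 u w) = ten2 (op a u) w.
Proof.
by move=> opb; rewrite /lact2 (lift2_ten2 (lact2_fun_bilinear a opb)).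
Qed.

Lemma ract2_ten2 u w b : ract2 (ten2 u w) b = ten2 u (mulp w b).
Proof. by rewrite /ract2 (lift2_ten2 (ract2_fun_bilinear b)). Qed.

Lemma lact2_ract2 (op : A -> A -> A) a t b : bilinear2 op ->
  lact2 op a (ract2 t b) = ract2 (lact2 op a t) b.
Proof.
move=> opb; have l1 := (lact2_bilinear opb).1 a; have l2 := ract2_bilinear.2 b.
move: t; apply: ten2_ext; [exact: (linear_comp l1 l2)
  |exact: (linear_comp l2 l1)|].
by move=> u w; rewrite lact2_ten2 // !ract2_ten2 lact2_ten2.
Qed.

Lemma ract2A t a b : ract2 (ract2 t a) b = ract2 t (mulp a b).
Proof.
have l a := ract2_bilinear.2 a.
move: t; apply: ten2_ext; [exact: (linear_comp (l b) (l a))|exact: l|].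
by move=> u w; rewrite !ract2_ten2 mulpA.
Qed.

Lemma lact2A (op : A -> A -> A) a b t : bilinear2 op ->
  (forall u, op (mulp a b) u = op a (op b u)) ->
  lact2 op (mulp a b) t = lact2 op a (lact2 op b t).
Proof.
move=> opb opA; have l a := (lact2_bilinear opb).1 a.
move: t; apply: ten2_ext; [exact: l|exact: (linear_comp (l a) (l b))|].
by move=> u w; rewrite !lact2_ten2 // opA.
Qed.

Lemma lift2_lact2 (op op' : A -> A -> A) a t :
  bilinear2 op -> bilinear2 op' ->
  (forall u w, op (op' a u) w = sea a (op u w)) ->
  lift2 op (lact2 op' a t) = sea a (lift2 op t).
Proof.
move=> opb op'b opE; have lL := lift2_linear opb.
move: t; apply: ten2_ext => [||u w].
- exact: (linear_comp lL ((lact2_bilinear op'b).1 a)).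
- exact: (linear_comp (sea_linearr a) lL).
by rewrite lact2_ten2 // !(lift2_ten2 opb).
Qed.

Lemma lift2_ract2 (op : A -> A -> A) t b : bilinear2 op ->
  (forall u w, op u (mulp w b) = mulp (op u w) b) ->
  lift2 op (ract2 t b) = mulp (lift2 op t) b.
Proof.
move=> opb opE; have lL := lift2_linear opb.
move: t; apply: ten2_ext => [||u w].
- exact: (linear_comp lL (ract2_bilinear.2 b)).
- exact: (linear_comp (mulp_linearl b) lL).
by rewrite ract2_ten2 !(lift2_ten2 opb).
Qed.

(** [A * (A (x) A)] stands for [A^+ (x) A], where [A^+] is [A] with a unit added
    and the component [A] is [1 (x) A]. The left action multiplies the factor in
    [A^+]; hence it sends [1 (x) u] to [a (x) u]. *)
Definition leftL (a : A) (x : A * tpow A 2) : A * tpow A 2 :=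
  (0, lact2 mulp a x.2 + ten2 a x.1).
Definition leftR (x : A * tpow A 2) (b : A) : A * tpow A 2 :=
  (mulp x.1 b, ract2 x.2 b).

(** Likewise [A * (A (x) A)] stands here for [A (x) A^+]. *)
Definition rightL (a : A) (x : A * tpow A 2) : A * tpow A 2 :=
  (sea a x.1, lact2 sea a x.2).
Definition rightR (x : A * tpow A 2) (b : A) : A * tpow A 2 :=
  (0, ract2 x.2 b + ten2 x.1 b).

Lemma fst_linear (U V : lmodType K) : linear (@fst U V).
Proof. by []. Qed.

Lemma snd_linear (U V : lmodType K) : linear (@snd U V).
Proof. by []. Qed.

Lemma left_bimodule : bimodule leftL leftR.
Proof.
have mb := mulp_bilinear A; have [ml mr] := mb.
have [ll lr] := lact2_bilinear mb; have [rl rr] := ract2_bilinear.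
have [tl tr] := ten2_bilinear A.
have f1 := @fst_linear A (tpow A 2); have f2 := @snd_linear A (tpow A 2).
split.
- split=> [a|x]; apply: linear_pair; try exact: linear_zero;
    apply: linear_add => //.
  + exact: (linear_comp (ll a) f2).
  + exact: (linear_comp (tl a) f1).
- split=> [x|b]; apply: linear_pair => //.
  + exact: (linear_comp (mr b) f1).
  + exact: (linear_comp (rr b) f2).
- move=> a b x; congr pair => /=.
  rewrite (lin0 (tl _)) addr0 (lin_add (ll a)) lact2_ten2 // lact2A //.
  by move=> u; rewrite mulpA.
- move=> a x b; congr pair => /=; first by rewrite (lin0 (mr b)).
  by rewrite (lin_add (rr b)) lact2_ract2 // ract2_ten2.
- by move=> x a b; congr pair => /=; rewrite ?mulpA ?ract2A.
Qed.

Lemma right_bimodule : bimodule rightL rightR.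
Proof.
have sb := sea_bilinear A; have [sl sr] := sb.
have [ll lr] := lact2_bilinear sb; have [rl rr] := ract2_bilinear.
have [tl tr] := ten2_bilinear A.
have f1 := @fst_linear A (tpow A 2); have f2 := @snd_linear A (tpow A 2).
split.
- split=> [a|x]; apply: linear_pair => //.
  + exact: (linear_comp (sl a) f1).
  + exact: (linear_comp (ll a) f2).
- split=> [x|b]; apply: linear_pair; try exact: linear_zero;
    apply: linear_add => //.
  + exact: (linear_comp (rr b) f2).
  + exact: (linear_comp (tr b) f1).
- move=> a b x; congr pair => /=; first by rewrite sea_mulp.
  by rewrite lact2A // => u; rewrite sea_mulp.
- move=> a x b; congr pair => /=; first by rewrite (lin0 (sl a)).
  by rewrite (lin_add (ll a)) lact2_ract2 // lact2_ten2.
- move=> x a b; congr pair => /=.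
  by rewrite (lin0 (tr b)) addr0 (lin_add (rr b)) ract2A ract2_ten2.
Qed.

Lemma regular_bimodule : bimodule (@sea K A) (@mulp K A).
Proof.
split; [exact: sea_bilinear|exact: mulp_bilinear|exact: sea_mulp
       |exact: mulp_sea|exact: mulpA].
Qed.

Lemma id_bimod_morphism : bimod_morphism (@sea K A) (@mulp K A) id.
Proof. by split. Qed.

(** A map to a bimodule with zero actions is a linear map killing both products,
    which is how degree zero homology sees [A]. *)
Lemma zero_bimodule (V : lmodType K) :
  bimodule (fun (_ : A) (_ : V) => 0) (fun (_ : V) (_ : A) => 0).
Proof. by split=> //; split=> ?; exact: linear_zero. Qed.

Variables (I : Type) (gen : I -> A).
Hypothesis freeA : pse_free gen.

(** The bimodule map sending each generator [x] to [(x, 0)]. In terms of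
    forests, [a] is uniquely [(F sea x) G] with [F] and [G] possibly empty;
    [sigma] extracts [F (x) xG], and [pi] keeps the [a] for which [F] is
    empty. *)
Lemma left_splitting : exists (pi : A -> A) (sigma : A -> tpow A 2),
  [/\ linear sigma,
      forall a b, sigma (mulp a b) = ract2 (sigma a) b,
      forall a b, sigma (sea a b) = lact2 mulp a (sigma b) + ten2 a (pi b)
    & forall a, lift2 sea (sigma a) + pi a = a].
Proof.
have [f [fL fm fs] fg] :=
  free_bimodule_ex freeA (fun i => (gen i, 0)) left_bimodule.
have sb := sea_bilinear A; have lL := lift2_linear sb.
have sL : linear (fun a => (f a).2) by move=> c a b; rewrite fL.
have pL : linear (fun a => (f a).1) by move=> c a b; rewrite fL.
exists (fun a => (f a).1), (fun a => (f a).2).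
split=> // [a b|a b|]; rewrite ?fm ?fs //.
(* Both sides are bimodule endomorphisms fixing the generators. *)
apply: (free_bimodule_uniq freeA regular_bimodule _ id_bimod_morphism).
  split=> [|a b|a b] /=.
  - exact: (linear_add (linear_comp lL sL) pL).
  - rewrite fm /= (lin_add (mulp_linearl b)) lift2_ract2 // => u w.
    exact: mulp_sea.
  - rewrite fs /= addr0 (lin_add lL) (lin_add (sea_linearr a)) (lift2_ten2 sb).
    rewrite (lift2_lact2 _ sb (mulp_bilinear A)) // => u w; exact: sea_mulp.
by move=> i; rewrite fg /= (lin0 lL) add0r.
Qed.

(** The mirror image: [tau] extracts [(F sea x) (x) G], and [rho] keeps the [a]
    for which [G] is empty. *)
Lemma right_splitting : exists (rho : A -> A) (tau : A -> tpow A 2),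
  [/\ linear tau,
      forall a b, tau (mulp a b) = ract2 (tau a) b + ten2 (rho a) b
    & forall a, lift2 mulp (tau a) + rho a = a].
Proof.
have [f [fL fm fs] fg] :=
  free_bimodule_ex freeA (fun i => (gen i, 0)) right_bimodule.
have mb := mulp_bilinear A; have lL := lift2_linear mb.
have sL : linear (fun a => (f a).2) by move=> c a b; rewrite fL.
have pL : linear (fun a => (f a).1) by move=> c a b; rewrite fL.
exists (fun a => (f a).1), (fun a => (f a).2).
split=> // [a b|]; rewrite ?fm //.
apply: (free_bimodule_uniq freeA regular_bimodule _ id_bimod_morphism).
  split=> [|a b|a b] /=.
  - exact: (linear_add (linear_comp lL sL) pL).
  - rewrite fm /= addr0 (lin_add lL) (lin_add (mulp_linearl b)) (lift2_ten2 mb).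
    rewrite lift2_ract2 // => u w; by rewrite mulpA.
  - rewrite fs /= (lin_add (sea_linearr a)).
    rewrite (lift2_lact2 _ mb (sea_bilinear A)) //.
    by move=> u w; rewrite mulp_sea.
by move=> i; rewrite fg /= (lin0 lL) add0r.
Qed.

End Splittings.

(** * Splitting the dotted factor of a tensor *)

Section Split.
Variables (K : fieldType) (A : pseAlgType K).

Definition split n (k : 'I_n.+1) (v : {ffun 'I_n.+1 -> A}) (a b : A) :
    {ffun 'I_n.+2 -> A} :=
  [ffun j : 'I_n.+2 => if (j < k)%N then v (inord j)
     else if j == k :> nat then a else if j == k.+1 :> nat then b
     else v (inord j.-1)].

Lemma split_inord n (k : 'I_n.+1) v a b m : (m <= n.+1)%N ->
  split k v a b (inord m) = if (m < k)%N then v (inord m)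
     else if m == k then a else if m == k.+1 then b else v (inord m.-1).
Proof. by move=> mn; rewrite ffunE /= !inordK. Qed.

Lemma contract_split n (k : 'I_n.+1) v a b op :
  contract op k (split k v a b) = upd v k (op a b).
Proof.
apply/ffunP => j; have jn := ltn_ord j; have kn := ltn_ord k.
rewrite !ffunE -!val_eqE /= !inordK ?ltnn ?eqxx; try lia.
have -> : (k.+1 < k)%N = false by lia.
have -> : (k.+1 == k)%N = false by lia.
case: ltngtP => jk; rewrite ?inord_val //.
have -> : (j.+1 < k)%N = false by lia.
have -> : (j.+1 == k)%N = false by lia.
have -> : (j.+1 == k.+1)%N = false by lia.
by [].
Qed.

(** Contracting away from the split pair is contracting [v] first and splitting
    afterwards, a neighbour of factor [k] being absorbed into [a] or [b]. The
    contractions of the split tensor other than [k] are indexed by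
    [lift k i]. *)
Lemma contract_split_lift n (k : 'I_n.+2) (i : 'I_n.+1) v a b :
  contract mulp (lift k i) (split k v a b) =
  split (redot i k) (contract (opk i k) i v)
    (if i.+1 == k then mulp (v (inord i)) a else a)
    (if i == k :> nat then mulp b (v (inord i.+1)) else b).
Proof.
have iN := ltn_ord i; have kN := ltn_ord k.
apply/ffunP => j; have jN := ltn_ord j.
rewrite [LHS]ffunE [RHS]ffunE -!val_eqE /= /bump /unbump.
have opE : i.+1 <> k -> opk i k = @mulp K A by rewrite /opk; case: eqP.
rewrite !split_inord; try lia.
case: (ltnP i k) => ik /=; rewrite ?add0n ?add1n ?subn0 ?subn1;
  do ! case: ifP => ? //; try lia; rewrite ?contract_inord; try lia;
  do ! case: ifP => ? //; try lia; rewrite ?opE //; try lia;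
  try (congr (v (inord _)); lia); try (congr (mulp _ (v (inord _))); lia).
Qed.

Lemma split_upd_dot n (k : 'I_n.+1) v c a b :
  split k (upd v k c) a b = split k v a b.
Proof.
apply/ffunP => j; have jn := ltn_ord j; have kn := ltn_ord k.
rewrite !ffunE -!val_eqE /=.
case: ltngtP => jk //; rewrite inordK; try lia.
  by have -> : (j == k :> nat) = false by lia.
case: eqP => // jk1; by have -> : (j.-1 == k :> nat) = false by lia.
Qed.

Lemma split_upd n (k l : 'I_n.+1) v c a b : l != k ->
  split k (upd v l c) a b =
  upd (split k v a b) (inord (if (l < k)%N then l : nat else l.+1)) c.
Proof.
rewrite -val_eqE /= => lk; have ln := ltn_ord l; have kn := ltn_ord k.
have mn : ((if (l < k)%N then l : nat else l.+1) < n.+2)%N by case: ifP; lia.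
apply/ffunP => j; have jn := ltn_ord j.
rewrite !ffunE -!val_eqE /= (inordK mn).
have -> : (j == (if (l < k)%N then l : nat else l.+1) :> nat) =
    if (l < k)%N then j == l :> nat else j == l.+1 :> nat by case: ifP.
case: (ltnP l k) => lk'; case: (ltngtP j k) => jk; rewrite ?inordK; try lia;
  by do ! case: ifP => ? //; lia.
Qed.

Lemma split_bilinear n (k : 'I_n.+1) v :
  bilinear2 (fun a b => tens (split k v a b)).
Proof.
have kn := ltn_ord k.
have E0 a b : split k v a b = upd (split k v 0 b) (inord k) a.
  apply/ffunP => j; rewrite !ffunE -!val_eqE /= inordK; last by lia.
  by case: ltngtP.
have E1 a b : split k v a b = upd (split k v a 0) (inord k.+1) b.
  apply/ffunP => j; rewrite !ffunE -!val_eqE /= inordK; last by lia.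
  do ! case: ifP => ? //; lia.
split=> [a|b] c x y.
  by rewrite (E1 _ (_ + _)) (E1 _ x) (E1 _ y) tens_multilinear.
by rewrite (E0 (_ + _)) (E0 x) (E0 y) tens_multilinear.
Qed.

Definition split_tens n (k : 'I_n.+1) (v : {ffun 'I_n.+1 -> A}) :
    tpow A 2 -> tpow A n.+2 :=
  lift2 (fun a b => tens (split k v a b)).

Lemma split_tens_linear n (k : 'I_n.+1) v : linear (split_tens k v).
Proof. exact/lift2_linear/split_bilinear. Qed.

Lemma split_tens_ten2 n (k : 'I_n.+1) v a b :
  split_tens k v (ten2 a b) = tens (split k v a b).
Proof. exact: (lift2_ten2 (split_bilinear k v)). Qed.

(** Makes [v |-> split_tens k v (theta (v k))] factor through the tensor power,
    so that the homotopies are well defined. *)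
Lemma split_tens_multilinear n (k : 'I_n.+1) (theta : A -> tpow A 2) :
  linear theta -> multilinear (fun v => split_tens k v (theta (v k))).
Proof.
move=> thL v l c a b; rewrite !ffunE eq_sym.
have [->|lk] := eqVneq l k.
  have E x t : split_tens k (upd v k x) t = split_tens k v t.
    by congr tlift; apply/funext => u; rewrite split_upd_dot.
  by rewrite !E thL split_tens_linear.
move: (theta _); apply: ten2_ext => [|d s t|x y].
- exact: split_tens_linear.
- rewrite !split_tens_linear !scalerDr !scalerA !(mulrC c).
  by rewrite addrACA.
by rewrite !split_tens_ten2 !split_upd // tens_multilinear.
Qed.

Lemma contract_bilinear n (op : A -> A -> A) (i : 'I_n) :
  bilinear2 op -> multilinear (fun v => tens (contract op i v)).
Proof.
case=> opr opl v l c a b; rewrite !contract_upd.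
by case: ifP => _; [|case: ifP => _]; rewrite ?opl ?opr tens_multilinear.
Qed.

Lemma face_split_tens n (op : A -> A -> A) (k : 'I_n.+1) v t : bilinear2 op ->
  face op k (split_tens k v t) = tens (upd v k (lift2 op t)).
Proof.
move=> opb; have cm := contract_bilinear k opb; move: t.
apply: ten2_ext => [c s t|c s t|a b].
- by rewrite split_tens_linear; apply: tlift_linear.
- by rewrite (lift2_linear opb) tens_multilinear.
rewrite split_tens_ten2 (lift2_ten2 opb) /face (tlift_tens cm).
by rewrite contract_split.
Qed.

(** What contracting [lift k i] does to the pair in which factor [k] of [v] has
    been split. *)
Definition absorb n (k : 'I_n.+2) (i : 'I_n.+1) (v : {ffun 'I_n.+2 -> A}) :
    tpow A 2 -> tpow A 2 :=
  lift2 (fun a b =>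
    ten2 (if i.+1 == k then mulp (v (inord i)) a else a)
         (if i == k :> nat then mulp b (v (inord i.+1)) else b)).

Lemma absorb_bilinear n (k : 'I_n.+2) (i : 'I_n.+1) (v : {ffun 'I_n.+2 -> A}) :
  bilinear2 (fun a b =>
    ten2 (if i.+1 == k then mulp (v (inord i)) a else a)
         (if i == k :> nat then mulp b (v (inord i.+1)) else b)).
Proof.
split=> [a|b] c x y.
  by case: (i == k :> nat); rewrite ?mulp_linearl (ten2_bilinear A).1.
by case: (i.+1 == k); rewrite ?mulp_linearr (ten2_bilinear A).2.
Qed.

Lemma face_split_tens_lift n (k : 'I_n.+2) (i : 'I_n.+1) v t :
  face mulp (lift k i) (split_tens k v t) =
  split_tens (redot i k) (contract (opk i k) i v) (absorb k i v t).
Proof.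
have cm := contract_bilinear (lift k i) (mulp_bilinear A); move: t.
have sb := absorb_bilinear k i v.
apply: ten2_ext => [c s t|c s t|a b].
- by rewrite split_tens_linear; apply: tlift_linear.
- by rewrite /absorb (lift2_linear sb) split_tens_linear.
rewrite split_tens_ten2 /absorb (lift2_ten2 sb) split_tens_ten2.
rewrite /face (tlift_tens cm).
by rewrite contract_split_lift.
Qed.

(** * Contracting homotopies *)

Lemma contract_redot n (k : 'I_n.+1) (i : 'I_n) (v : {ffun 'I_n.+1 -> A}) :
  contract (opk i k) i v (redot i k) =
  if i.+1 == k then sea (v (inord i)) (v k)
  else if i == k :> nat then mulp (v k) (v (inord i.+1)) else v k.
Proof.
have iN := ltn_ord i; have kN := ltn_ord k.
rewrite ffunE -val_eqE /= /unbump /opk.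
case: (ltnP i k) => ik /=; rewrite ?subn0 ?subn1.
  have -> : (k.-1 < i)%N = false by lia.
  have -> : (i == k :> nat) = false by lia.
  have -> : (k.-1 == i)%N = (i.+1 == k) by lia.
  case: eqP => [->|_]; first by rewrite inord_val.
  by have -> : k.-1.+1 = k by [lia]; rewrite inord_val.
have -> : (i.+1 == k)%N = false by lia.
rewrite eq_sym; case: eqP => [->|nik]; first by rewrite ltnn inord_val.
have -> : (k < i)%N by lia.
by rewrite inord_val.
Qed.

Lemma dsea_tinj n (k : 'I_n.+1) (t : tpow A n.+1) :
  dsea (tinj k t) =
  \sum_(i < n) (-1) ^+ i *: tinj (redot i k) (face (opk i k) i t).
Proof.
rewrite /dsea (bigD1 k) //= [X in _ + X]big1 ?addr0 => [|l lk].
  by apply: eq_bigr => i _; rewrite ffunE eqxx.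
apply: big1 => i _; rewrite ffunE (negPf lk).
by rewrite (lin0 (face_linear i l)) (lin0 (tinj_linear _)) scaler0.
Qed.

Lemma absorb_left n (k : 'I_n.+2) (i : 'I_n.+1) (v : {ffun 'I_n.+2 -> A}) t :
  i.+1 = k -> absorb k i v t = lact2 mulp (v (inord i)) t.
Proof.
move=> ik; rewrite /absorb ik eqxx.
by have -> : (i == k :> nat) = false by lia.
Qed.

Lemma absorb_right n (k : 'I_n.+2) (i : 'I_n.+1) (v : {ffun 'I_n.+2 -> A}) t :
  i = k :> nat -> absorb k i v t = ract2 t (v (inord i.+1)).
Proof.
move=> ik; rewrite /absorb ik eqxx.
by have -> : (k.+1 == k :> nat) = false by lia.
Qed.

Lemma absorb_none n (k : 'I_n.+2) (i : 'I_n.+1) (v : {ffun 'I_n.+2 -> A}) t :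
  i.+1 != k -> i != k :> nat -> absorb k i v t = t.
Proof.
move=> /negPf ik /negPf ik'; rewrite /absorb ik ik'; move: t.
apply: (ten2_ext (g := id)) => //; first exact/lift2_linear/ten2_bilinear.
by move=> a b; rewrite (lift2_ten2 (ten2_bilinear A)).
Qed.

Lemma split_contract_left n (op : A -> A -> A) (k : 'I_n.+2) (i : 'I_n.+1)
    (v : {ffun 'I_n.+2 -> A}) c :
  i.+1 = k -> split (redot i k) (contract op i v) (v (inord i)) c = upd v k c.
Proof.
move=> ik; apply/ffunP => j; have jN := ltn_ord j; have iN := ltn_ord i.
rewrite !ffunE -!val_eqE /= /unbump.
have -> : (k - (i < k))%N = i by lia.
rewrite -ik; case: (ltngtP j i) => ji; last 1 first.
- by rewrite ji; case: eqP => [|_]; [lia|rewrite -ji inord_val].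
- have -> : (j == i.+1 :> nat) = false by lia.
  by rewrite inordK ?ji ?inord_val //; lia.
case: eqP => // ji1; rewrite inordK; last lia.
have -> : (j.-1 < i)%N = false by lia.
have -> : (j.-1 == i)%N = false by lia.
by have -> : j.-1.+1 = j by [lia]; rewrite inord_val.
Qed.

Lemma split_contract_right n (op : A -> A -> A) (v : {ffun 'I_n.+2 -> A}) c :
  split ord0 (contract op ord0 v) c (v (inord 1)) = upd v ord0 c.
Proof.
apply/ffunP => j; have jN := ltn_ord j.
rewrite !ffunE -!val_eqE /=.
case: eqP => // j0; case: eqP => [<-|j1]; first by rewrite inord_val.
rewrite inordK; last lia.
have -> : (j.-1 == 0)%N = false by lia.
by have -> : j.-1.+1 = j by [lia]; rewrite inord_val.
Qed.

Lemma dtens_upd_linear n (k : 'I_n) (v : {ffun 'I_n -> A}) l :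
  linear (fun a => dtens k (upd v l a)).
Proof. by move=> c a b; rewrite /dtens tens_multilinear tinj_linear. Qed.

Lemma upd_id n (v : {ffun 'I_n -> A}) k : upd v k (v k) = v.
Proof. by apply/ffunP => j; rewrite ffunE; case: eqP => [->|]. Qed.

Lemma redot_lift_same n (k : 'I_n.+1) : redot k (lift ord0 k) = k.
Proof. by apply/val_inj; rewrite /= /unbump /bump /=; lia. Qed.

Lemma redot_lift_lift n (k : 'I_n.+2) (i : 'I_n.+1) :
  redot (lift k i) (lift ord0 k) = lift ord0 (redot i k).
Proof. by apply/val_inj; rewrite /= /unbump /bump /=; lia. Qed.

Lemma opk_lift_same n (k : 'I_n.+1) : opk (A := A) k (lift ord0 k) = sea.
Proof. by rewrite /opk /= /bump add1n eqxx. Qed.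

Lemma opk_lift_lift n (k : 'I_n.+2) (i : 'I_n.+1) :
  opk (A := A) (lift k i) (lift ord0 k) = mulp.
Proof. by rewrite /opk /= /bump; case: eqP => //; case: leqP; lia. Qed.

Lemma sign_lift_redot n (k : 'I_n.+2) (i : 'I_n.+1) :
  (-1) ^+ (k + lift k i) = - (-1) ^+ (i + redot i k) :> K.
Proof.
rewrite -[RHS]mulN1r -exprS -[LHS]signr_odd -[RHS]signr_odd.
congr (_ ^+ (nat_of_bool _)).
by rewrite /= /bump /unbump; case: (ltnP i k); lia.
Qed.

(** The extracted left factor joins the undotted factors on the left, so that
    the dot moves to the right; the sign makes the contraction of the split
    pair, of index [k], appear with coefficient 1 in the differential. *)
Definition left_homotopy (sigma : A -> tpow A 2) n (x : Tsea A n.+1) :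
    Tsea A n.+2 :=
  \sum_(k < n.+1) (-1) ^+ k *:
    tinj (lift ord0 k) (tlift (fun v => split_tens k v (sigma (v k))) (x k)).

(** Only used on chains dotted on their first factor, where no sign is needed:
    the split pair has index 0. *)
Definition right_homotopy (tau : A -> tpow A 2) n (x : Tsea A n.+1) :
    Tsea A n.+2 :=
  tinj ord0 (tlift (fun v => split_tens ord0 v (tau (v ord0))) (x ord0)).

Section LeftHomotopy.
Variables (sigma : A -> tpow A 2) (pi : A -> A).
Hypothesis sigmaL : linear sigma.

Lemma left_homotopy_linear n : linear (@left_homotopy sigma n).
Proof.
move=> c x y; rewrite /left_homotopy scaler_sumr -big_split /=.
apply: eq_bigr => k _.
rewrite !ffunE (tlift_linear (split_tens_multilinear k sigmaL)) tinj_linear.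
by rewrite scalerDr !scalerA mulrC.
Qed.

Lemma left_homotopy_dtens n (k : 'I_n.+1) v :
  left_homotopy sigma (dtens k v) =
  (-1) ^+ k *: tinj (lift ord0 k) (split_tens k v (sigma (v k))).
Proof.
rewrite /left_homotopy (bigD1 k) //= [X in _ + X]big1 ?addr0 => [|l lk].
  by rewrite ffunE eqxx (tlift_tens (split_tens_multilinear k sigmaL)).
rewrite ffunE (negPf lk).
rewrite (lin0 (tlift_linear (split_tens_multilinear l sigmaL))).
by rewrite (lin0 (tinj_linear _)) scaler0.
Qed.

Hypothesis sigma_mulp : forall a b,
  sigma (mulp a b) = ract2 (sigma a) b.
Hypothesis sigma_sea : forall a b,
  sigma (sea a b) = lact2 mulp a (sigma b) + ten2 a (pi b).
Hypothesis sigma_pi : forall a, lift2 sea (sigma a) + pi a = a.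

(** The contraction of the split pair gives [id - pi] on the dotted factor. All
    other terms of [d h + h d] cancel in pairs, since [sigma] commutes with the
    actions, except the one coming from the summand [ten2 a (pi b)] of
    [sigma (sea a b)]: it restores the [pi] term, unless the dot is on the first
    factor and there is no left neighbour. *)
Lemma left_homotopy_contraction n (x : Tsea A n.+2) :
  exists t, dsea (left_homotopy sigma x) + left_homotopy sigma (dsea x) =
            x - tinj ord0 t.
Proof.
elim/Tsea_ind: x => [k v||c x y [t tx] [u uy]].
- pose e : Tsea A n.+2 := dtens k (upd v k (pi (v k))).
  suff main : dsea (left_homotopy sigma (dtens k v)) +
      left_homotopy sigma (dsea (dtens k v)) =
      dtens k v - e + (if k == ord0 then 0 else e).
    rewrite main; have [k0|k0] := eqVneq k ord0.
      by exists (tens (upd v k (pi (v k)))); rewrite addr0 /e k0.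
    by exists 0; rewrite subrK (lin0 (tinj_linear _)) subr0.
  (* Isolate the contraction of index [k], that of the split pair. *)
  rewrite left_homotopy_dtens linearZ /= dsea_tinj (bigD1_ord k) //= scalerDr.
  rewrite -addrA; congr (_ + _).
    rewrite scalerA -exprD addnn -signr_odd odd_double scale1r.
    rewrite redot_lift_same opk_lift_same.
    rewrite (face_split_tens _ _ _ (sea_bilinear A)).
    rewrite /e -[in dtens k v](upd_id v k) -{2}(sigma_pi (v k)).
    rewrite -[lift2 _ _ in RHS]scale1r (dtens_upd_linear k v k) scale1r.
    by rewrite addrK.
  rewrite dsea_dtens (linear_lincomb _ _ (@left_homotopy_linear n)).
  rewrite scaler_sumr -big_split.
  (* Pair the contraction [lift k i] after splitting with [i] before it. *)
  transitivity (\sum_(i < n.+1) if i.+1 == k then e else 0).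
    apply: eq_bigr => i _ /=.
    rewrite left_homotopy_dtens !scalerA -!exprD sign_lift_redot.
    rewrite redot_lift_lift opk_lift_lift face_split_tens_lift.
    rewrite scaleNr addrC -scalerBr.
    set sg := _ ^+ _.
    rewrite contract_redot.
    case: (eqVneq i.+1 (k : nat)) => [ik|nik]; last first.
      case: (eqVneq (i : nat) k) => [ik|nik']; last first.
        by rewrite absorb_none // subrr scaler0.
      by rewrite sigma_mulp absorb_right // subrr scaler0.
    (* Left neighbour: the extra summand of [sigma_sea] contributes [e]. *)
    rewrite sigma_sea absorb_left // -[lact2 _ _ _ in X in X - _]scale1r.
    rewrite split_tens_linear scale1r split_tens_ten2 split_contract_left //.
    rewrite -[split_tens _ _ _ in X in X - _]scale1r tinj_linear scale1r.
    rewrite addrAC subrr add0r.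
    have rk : lift ord0 (redot i k) = k.
      by apply/val_inj; rewrite /= /unbump /bump; case: (ltnP i k); lia.
    have ri : redot i k = i by apply/val_inj; rewrite /= /unbump; lia.
    by rewrite rk /sg ri addnn -signr_odd odd_double scale1r.
  case: (unliftP ord0 k) => [l|] ->.
    by rewrite -big_mkcond (big_pred1 l).
  by rewrite big1.
- exists 0; rewrite !(lin0 (@dsea_linear _ _ _)).
  rewrite !(lin0 (@left_homotopy_linear _)) !(lin0 (@dsea_linear _ _ _)).
  by rewrite (lin0 (tinj_linear _)) addr0 subrr.
- exists (c *: t + u); rewrite !(dsea_linear, left_homotopy_linear) tinj_linear.
  exact: lincomb_subr.
Qed.

End LeftHomotopy.

Section RightHomotopy.
Variables (tau : A -> tpow A 2) (rho : A -> A).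
Hypothesis tauL : linear tau.

Lemma right_homotopy_linear n : linear (@right_homotopy tau n).
Proof.
move=> c x y; rewrite /right_homotopy !ffunE -tinj_linear; congr tinj.
exact: (tlift_linear (split_tens_multilinear ord0 tauL)).
Qed.

Lemma right_homotopy_dtens n (v : {ffun 'I_n.+1 -> A}) :
  right_homotopy tau (dtens ord0 v) =
  tinj ord0 (split_tens ord0 v (tau (v ord0))).
Proof.
rewrite /right_homotopy ffunE eqxx.
by rewrite (tlift_tens (split_tens_multilinear ord0 tauL)).
Qed.

Hypothesis tau_mulp : forall a b,
  tau (mulp a b) = ract2 (tau a) b + ten2 (rho a) b.
Hypothesis tau_rho : forall a, lift2 mulp (tau a) + rho a = a.

(** Chains dotted on the first factor form a subcomplex, on which only the right
    action matters. The same cancellation takes place as on the left, the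
    missing [rho] term being restored by the summand [ten2 (rho a) b] of
    [tau (mulp a b)]: there is always a right neighbour here, because the
    chains have at least two factors. *)
Lemma right_homotopy_contraction n (t : tpow A n.+2) :
  dsea (right_homotopy tau (tinj ord0 t)) +
  right_homotopy tau (dsea (tinj ord0 t)) = tinj ord0 t.
Proof.
elim/tpow_ind: t => [v||c x y tx ty].
- pose e : Tsea A n.+2 := dtens ord0 (upd v ord0 (rho (v ord0))).
  rewrite -/(dtens ord0 v) right_homotopy_dtens dsea_tinj.
  rewrite (bigD1_ord ord0) //= scale1r.
  have r00 m : redot (ord0 : 'I_m.+1) ord0 = ord0 by exact/val_inj.
  rewrite r00 (face_split_tens _ _ _ (mulp_bilinear A)).
  have -> : tinj ord0 (tens (upd v ord0 (lift2 mulp (tau (v ord0))))) =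
      dtens ord0 v - e.
    rewrite /e -[in dtens ord0 v](upd_id v ord0) -{2}(tau_rho (v ord0)).
    rewrite -[lift2 _ _ in RHS]scale1r (dtens_upd_linear ord0 v ord0) scale1r.
    by rewrite addrK.
  rewrite dsea_dtens (linear_lincomb _ _ (@right_homotopy_linear n)).
  rewrite -addrA -big_split /=.
  rewrite (_ : \sum_(i < n.+1) _ = e) ?subrK //.
  transitivity (\sum_(i < n.+1) if i == ord0 then e else 0); last first.
    by rewrite -big_mkcond (big_pred1 ord0).
  apply: eq_bigr => i _ /=.
  have r0 : redot i ord0 = ord0 by apply/val_inj; rewrite /= /unbump.
  have rl : redot (lift ord0 i) ord0 = ord0.
    by apply/val_inj; rewrite /= /unbump.
  have := contract_redot ord0 i v; rewrite /= r0 => cE.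
  rewrite rl face_split_tens_lift r0 right_homotopy_dtens cE.
  rewrite /bump add1n exprS mulN1r scaleNr addrC -scalerBr.
  have [->|i0] := eqVneq i ord0; last first.
    have /negPf i0' : i != 0 :> nat by rewrite -val_eqE in i0.
    by rewrite i0' absorb_none ?i0' // subrr scaler0.
  rewrite /= tau_mulp absorb_right // -[ract2 _ _ in X in X - _]scale1r.
  rewrite split_tens_linear scale1r split_tens_ten2 split_contract_right.
  rewrite -[split_tens _ _ _ in X in X - _]scale1r tinj_linear scale1r.
  by rewrite addrAC subrr add0r scale1r.
- rewrite (lin0 (tinj_linear _)) (lin0 (@right_homotopy_linear _)).
  rewrite !(lin0 (@dsea_linear _ _ _)) (lin0 (@right_homotopy_linear _)).
  by rewrite addr0.
- rewrite tinj_linear !(dsea_linear, right_homotopy_linear).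
  exact: lincomb_addr.
Qed.

End RightHomotopy.

Variables (I : Type) (gen : I -> A).
Hypothesis freeA : pse_free gen.

(** The left homotopy moves a cycle to a homologous one dotted on its first
    factor, which the right homotopy shows to be a boundary. *)
Lemma acyclic n (x : Tsea A n.+2) :
  dsea x = 0 -> exists y : Tsea A n.+3, dsea y = x.
Proof.
have [pi [sigma [sL sm ss sp]]] := left_splitting freeA.
have [rho [tau [tL tm tp]]] := right_splitting freeA.
move=> dx; have [t] := left_homotopy_contraction sL sm ss sp x.
rewrite dx (lin0 (left_homotopy_linear sL (n := _))) addr0 => xt.
have tE : tinj ord0 t = x - dsea (left_homotopy sigma x).
  by rewrite xt opprB addrC subrK.
have := right_homotopy_contraction tL tm tp t.
rewrite [in dsea (tinj ord0 t)]tE linearB /= dx dsea_dsea subrr.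
rewrite (lin0 (right_homotopy_linear tL (n := _))) addr0 => tR.
exists (left_homotopy sigma x + right_homotopy tau (tinj ord0 t)).
by rewrite linearD /= tR xt subrK.
Qed.

End Split.

(** * Homology in degree zero *)

Section DegreeZero.
Variables (K : fieldType) (A : pseAlgType K).

Lemma chain0_cycle (x : Tsea A 1) : x \in @cycle_pred K A 0.
Proof. by rewrite cycleE; apply/eqP/ffunP => -[]. Qed.

Definition class0 (x : Tsea A 1) : Hsea A 0 :=
  lpi (@boundary_pred K A 0) (Sub x (chain0_cycle x)).

Lemma class0_linear : linear class0.
Proof.
move=> c x y; rewrite /class0 -lpi_linear; congr lpi.
exact/val_inj.
Qed.

Lemma class0_surj (q : Hsea A 0) : exists x, class0 x = q.
Proof.
have [z <-] := lpi_surj q; exists (val z).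
by congr lpi; apply/val_inj; rewrite SubK.
Qed.

Lemma class0_eq (x y : Tsea A 1) :
  class0 x = class0 y <-> exists z : Tsea A 2, dsea z = x - y.
Proof.
rewrite /class0 lpi_eq; split=> [/asboolP|] [z zE]; last apply/asboolP;
  by exists z; rewrite zE.
Qed.

Definition vec_class (a : A) : Hsea A 0 := class0 (dtens ord0 [ffun => a]).

Lemma ffun1E (v : {ffun 'I_1 -> A}) : v = [ffun => v ord0].
Proof. by apply/ffunP => j; rewrite ffunE (ord1 j). Qed.

Lemma vec_class_linear : linear vec_class.
Proof.
move=> c a b; rewrite /vec_class -class0_linear; congr class0.
have E x : [ffun => x] = upd [ffun => 0 : A] (ord0 : 'I_1) x.
  by apply/ffunP => j; rewrite !ffunE (ord1 j).
by rewrite (E (_ + _)) (E a) (E b) (dtens_upd_linear _ _ _ c).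
Qed.

Lemma dsea_dtens2 (k : 'I_2) (v : {ffun 'I_2 -> A}) :
  dsea (dtens k v) =
  dtens ord0 [ffun => (if k == ord0 then mulp else sea) (v ord0) (v ord_max)].
Proof.
rewrite dsea_dtens big_ord1 scale1r (ord1 (redot _ _)); congr (dtens _ _).
rewrite [LHS]ffun1E ffunE /=; apply/ffunP => j; rewrite !ffunE.
have -> : (inord 0 : 'I_2) = ord0 by apply/val_inj; rewrite /= inordK.
have -> : (inord 1 : 'I_2) = ord_max by apply/val_inj; rewrite /= inordK.
by case: k => -[|[|//]].
Qed.

Lemma vec_class_prod a b : vec_class (mulp a b) = 0 /\ vec_class (sea a b) = 0.
Proof.
have E (k : 'I_2) : vec_class ((if k == ord0 then mulp else sea) a b) = 0.
  rewrite -(lin0 class0_linear); apply/class0_eq.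
  exists (dtens k [ffun j : 'I_2 => if j == ord0 then a else b]).
  by rewrite subr0 dsea_dtens2 !ffunE.
by split; [exact: (E ord0)|exact: (E ord_max)].
Qed.

Section Lift.
Variables (V : lmodType K) (phi : A -> V).
Hypothesis phiL : linear phi.

Definition lift0 (x : Tsea A 1) : V :=
  tlift (fun v : {ffun 'I_1 -> A} => phi (v ord0)) (x ord0).

Fact lift0_multilinear :
  multilinear (fun v : {ffun 'I_1 -> A} => phi (v ord0)).
Proof. by move=> v i c a b; rewrite !ffunE !(ord1 i) eqxx phiL. Qed.

Lemma lift0_linear : linear lift0.
Proof.
by move=> c x y; rewrite /lift0 !ffunE (tlift_linear lift0_multilinear).
Qed.

Lemma lift0_dtens k v : lift0 (dtens k v) = phi (v ord0).
Proof. by rewrite (ord1 k) /lift0 ffunE eqxx (tlift_tens lift0_multilinear). Qed.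

Lemma lift0_boundary (z : Tsea A 2) :
  (forall a b, phi (mulp a b) = 0) -> (forall a b, phi (sea a b) = 0) ->
  lift0 (dsea z) = 0.
Proof.
move=> phim phis; elim/Tsea_ind: z => [k v||c x y Fx Fy].
- by rewrite dsea_dtens2 lift0_dtens ffunE; case: ifP.
- by rewrite linear0 (lin0 lift0_linear).
by rewrite dsea_linear lift0_linear; apply: lincomb0.
Qed.

End Lift.

End DegreeZero.

Unset Implicit Arguments.
Set Strict Implicit.

Theorem theorem6 (K : fieldType) (D : nat) (hD : (1 <= D)%N)
    (A : pseAlgType K) (gen : 'I_D -> A) (hA : pse_free gen) :
  (exists2 f : Hsea A 0 -> 'rV[K]_D, linear f & bijective f) /\
  (forall n : nat, (1 <= n)%N -> forall x : Hsea A n, x = 0).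
Proof.
split; last first.
  case=> // n _ q; have [z <-] := lpi_surj q.
  rewrite -(lin0 (@lpi_linear _ _ _)); apply/lpi_eq; rewrite subr0.
  apply/asboolP; apply: (acyclic hA); apply/eqP; rewrite -cycleE.
  exact: valP.
(* Coordinates on the generators, killing both products. *)
have zb V := @zero_bimodule K A V.
have [phi [phiL phim phis] phig] :=
  free_bimodule_ex hA (fun i => delta_mx 0 i : 'rV[K]_D) (zb _).
pose g (r : 'rV[K]_D) : Hsea A 0 := vec_class (\sum_i r 0 i *: gen i).
have gL : linear g.
  move=> c r s; rewrite /g -vec_class_linear; congr vec_class.
  rewrite scaler_sumr -big_split; apply: eq_bigr => i _ /=.
  by rewrite !mxE scalerDl scalerA.
(* Two maps to the bimodule [Hsea A 0] with zero actions. *)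
have gphi a : g (phi a) = vec_class a.
  move: a; apply: (free_bimodule_uniq hA (zb _)).
  - split=> [|a b|a b]; first exact: (linear_comp gL phiL).
      by rewrite phim (lin0 gL).
    by rewrite phis (lin0 gL).
  - split=> [|a b|a b]; first exact: vec_class_linear.
      exact: (vec_class_prod a b).1.
    exact: (vec_class_prod a b).2.
  move=> i; rewrite /g phig; congr vec_class; rewrite (bigD1 i) //= mxE !eqxx.
  rewrite scale1r big1 ?addr0 // => j ji.
  by rewrite mxE (negPf ji) scale0r.
have FL := lift0_linear phiL.
have gF x : g (lift0 phi x) = class0 x.
  elim/Tsea_ind: x => [k v||c x y gx gy].
  - by rewrite (lift0_dtens phiL) gphi /vec_class (ord1 k) -ffun1E.
  - by rewrite (lin0 FL) (lin0 gL) (lin0 (@class0_linear _ _)).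
  - by rewrite FL gL class0_linear gx gy.
have Fcl x y : class0 x = class0 y -> lift0 phi x = lift0 phi y.
  move=> /class0_eq [z dz]; apply/eqP; rewrite -subr_eq0; apply/eqP.
  have := FL (-1) y x; rewrite !scaleN1r => FB.
  by rewrite addrC -FB addrC -dz (lift0_boundary phiL).
pose f (q : Hsea A 0) := lift0 phi (val (repr q)).
have fE x : f (class0 x) = lift0 phi x.
  apply: Fcl; have [z zE] : exists z, class0 z = class0 x by exists x.
  rewrite -[RHS](reprK (class0 x)); congr lpi; apply/val_inj.
  by rewrite SubK.
exists f.
  move=> c q r; have [x <-] := class0_surj q; have [y <-] := class0_surj r.
  by rewrite -class0_linear !fE FL.
exists g => [q|r].
  by have [x <-] := class0_surj q; rewrite fE gF.
rewrite /g /vec_class fE (lift0_dtens phiL) ffunE (linear_lincomb _ _ phiL).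
rewrite [RHS]row_sum_delta; apply: eq_bigr => i _.
by rewrite phig.
Qed.
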